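(* If $G$ is an outerplanar graph with maximum degree $\Delta(G)\geq 2$, then $\chi^d_i(G)=\Delta(G)$ for every integer $d\geq 2$.
   Context: All graphs are simple. An outerplanar graph is a graph that can be embedded in the plane with all vertices on the outer face. For a graph $G$, an incidence is a pair $(v,e)$ with $v\in V(G)$ an endpoint of the edge $e\in E(G)$; $I(G)$ is the set of all incidences. For $u\in V(G)$ and a neighbor $v$ of $u$, $(u,uv)$ is a strong incidence of $u$ and $(v,uv)$ is a weak incidence of $u$; $I_u$ and $A_u$ denote the sets of strong and weak incidences of $u$. For a map $\varphi$ on $I(G)$, $\varphi(I_u)=\{\varphi(u,uv): v\in N_G(u)\}$. Let $[k]=\{1,\dots,k\}$. A $d$-defective incidence $k$-coloring of $G$ is a map $\varphi: I(G)\to[k]$ such that for every $u\in V(G)$: (a) $\varphi(u,uv)\neq\varphi(u,uw)$ for distinct $v,w\in N_G(u)$; (b) $\varphi(u,uv)\neq\varphi(v,uv)$ for every $v\in N_G(u)$; (c) every color in $\varphi(I_u)$ appears at most $d$ times among the incidences of $A_u$. $\chi^d_i(G)$ is the minimum $k$ such that $G$ has a $d$-defective incidence $k$-coloring. *)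

(* Defs.v *)
From mathcomp Require Import all_boot all_order all_algebra.
From mathcomp Require Import all_classical all_reals all_analysis.
Set Implicit Arguments.
Unset Strict Implicit.
Unset Printing Implicit Defensive.
Import Order.TTheory GRing.Theory Num.Theory.
Import numFieldNormedType.Exports.

Record sgraph := SGraph {
  vertex :> finType;
  adj : rel vertex;
  adj_sym : symmetric adj;
  adj_irrefl : irreflexive adj }.

Section Combinatorics.
Variable G : sgraph.
Local Open Scope set_scope.
Implicit Types (u v : G) (d k : nat).

Definition edges : {set {set G}} :=
  [set [set p.1; p.2] | p in [set p : G * G | adj p.1 p.2]].

Definition neighbors u : {set G} := [set v | adj u v].

Definition max_degree : nat := \max_(u : G) #|neighbors u|.

Definition incidence : {set G * {set G}} :=
  [set i | (i.2 \in edges) && (i.1 \in i.2)].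

Definition strong_incidence u : {set G * {set G}} :=
  [set (u, [set u; v]) | v in neighbors u].

Definition weak_incidence u : {set G * {set G}} :=
  [set (v, [set u; v]) | v in neighbors u].

(* The values of [phi] outside of [incidence] are irrelevant. *)
Definition defective_incidence_coloring d k (phi : G * {set G} -> nat) : Prop :=
  {in incidence, forall i, 1 <= phi i <= k} /\
  forall u : G,
  [/\ {in neighbors u &, forall v w, v != w ->
        phi (u, [set u; v]) != phi (u, [set u; w])},
      {in neighbors u, forall v,
        phi (u, [set u; v]) != phi (v, [set u; v])}
    & forall c : nat, c \in [seq phi i | i in strong_incidence u] ->
        #|[set i in weak_incidence u | phi i == c]| <= d].

Definition defective_incidence_colorable d k : Prop :=
  exists phi, defective_incidence_coloring d k phi.

Lemma ex_defective_incidence_colorable d :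
  exists k, `[< defective_incidence_colorable d k >].
Proof.
exists #|{: G * {set G}}|; apply/asboolP.
exists (fun i => (enum_rank i).+1); split => [i _ | u]; first exact: ltn_ord.
have inj (i j : G * {set G}) : (enum_rank i).+1 = (enum_rank j).+1 -> i = j.
  by move=> ij; apply/enum_rank_inj/val_inj; case: ij.
have neq v : v \in neighbors u -> u != v.
  by rewrite inE; apply: contraL => /eqP <-; rewrite adj_irrefl.
split.
- move=> v w uv _ vw; apply/eqP => /inj [] /setP /(_ v).
  by rewrite !inE eqxx orbT (negbTE vw) eq_sym (negbTE (neq _ uv)).
- by move=> v uv; apply/eqP => /inj [] uv_eq; case/eqP: (neq _ uv).
- move=> c /fintype.imageP[i /imsetP[v uv ->] ->]; rewrite (_ : [set _ in _ | _] = finset.set0).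
    by rewrite cards0.
  apply/setP => j; rewrite !inE; apply/negP => /andP[/imsetP[w uw ->]] /eqP /inj.
  by case=> wu _; case/eqP: (neq _ uw).
Qed.

Definition defective_incidence_chromatic d : nat :=
  ex_minn (ex_defective_incidence_colorable d).

End Combinatorics.

Section Outerplanar.
Variables (R : realType) (G : sgraph).
Local Open Scope ring_scope.
Local Open Scope classical_set_scope.

(* [pos v] is the point representing the vertex [v], and the arc representing
   the edge [a] is the image of [0, 1] by [curve a]. *)
Record plane_embedding (pos : G -> R * R) (curve : {set G} -> R -> R * R) :
    Prop := PlaneEmbedding {
  pos_inj : injective pos;
  curve_continuous : forall a, a \in edges G ->
    {within `[0, 1], continuous (curve a)};
  curve_inj : forall a, a \in edges G ->
    {in `[0, 1] &, injective (curve a)};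
  curve_endpoints : forall a, a \in edges G ->
    [set curve a 0; curve a 1] = pos @` [set` a];
  curve_vertex : forall a, a \in edges G -> forall v (t : R),
    0 < t < 1 -> curve a t != pos v;
  curve_disjoint : forall a b, a \in edges G -> b \in edges G -> a != b ->
    forall s t : R, 0 < s < 1 -> 0 < t < 1 -> curve a s != curve b t }.

Definition drawing (pos : G -> R * R) (curve : {set G} -> R -> R * R) :
    set (R * R) :=
  range pos `|` \bigcup_(a in [set` edges G]) (curve a @` `[0, 1]).

Definition face (D F : set (R * R)) : Prop :=
  exists2 x, (~` D) x & F = connected_component (~` D) x.

Definition outer_face (D F : set (R * R)) : Prop :=
  face D F /\ ~ bounded_set F.

Definition outerplanar : Prop :=
  exists pos curve, plane_embedding pos curve /\
  exists2 F, outer_face (drawing pos curve) F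
           & forall v, closure F (pos v).

End Outerplanar.

(* Main.v *)
(** View the incidence [(u, uv)] as the arc from [u] to [v]. The edges of a graph
of maximum degree at most [2m] have an orientation with all in- and outdegrees at
most [m]; by Koenig's edge coloring theorem, applied to the bipartite graph whose
sides are the tails and the heads of the arcs, the oriented edges split into [m]
classes, each with in- and outdegrees at most 1. If [Delta = 2k], take [m = k] and
give two colors to each class, one for the oriented edges and one for their
reverses. If [Delta = 2k + 1], take [m = k + 1]: the forward color of class 0 also
serves some arcs of class 1, while the reverses of class 0 are recolored greedily,
which saves one color; a color then enters a vertex at most twice. *)
Require Import Defs.
From mathcomp Require Import all_boot all_order all_algebra.
From mathcomp Require Import all_classical all_reals all_analysis.
From mathcomp Require Import fintype finset zify.
Set Implicit Arguments.
Unset Strict Implicit.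
Unset Printing Implicit Defensive.

(** * Balanced orientations of multigraphs *)

Section Orientation.
Variable V : eqType.
Implicit Types (u v w x y : V) (l s : seq (V * V)).

Definition outdeg s v := count (fun e => e.1 == v) s.
Definition indeg s v := count (fun e => e.2 == v) s.
(** Both directions are counted, a loop twice, so [mult s =2 mult l] means that [s] and [l] orient
    the same multigraph. *)
Definition mult s x y := count_mem (x, y) s + count_mem (y, x) s.

Definition joins (e : V * V) x y : nat := (e == (x, y)) + (e == (y, x)).

Lemma mult_cons e s x y : mult (e :: s) x y = joins e x y + mult s x y.
Proof. rewrite /mult /joins /=; lia. Qed.

Lemma joins_flip u v x y : joins (u, v) x y = joins (v, u) x y.
Proof. rewrite /joins !xpair_eqE; lia. Qed.

Lemma mult_perm s s' x y : perm_eq s s' -> mult s x y = mult s' x y.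
Proof. by move=> /permP ss'; rewrite /mult !ss'. Qed.

Lemma mult_gt0 s x y : (0 < mult s x y) = ((x, y) \in s) || ((y, x) \in s).
Proof. by rewrite /mult addn_gt0 -!has_count !has_pred1. Qed.

(* Two edges [u v] and [v w] are lifted to the single edge [u w]; an orientation
   of the latter is pulled back to a path through [v]. *)
Lemma balanced_orientation l :
  exists2 s, mult s =2 mult l &
    forall v, outdeg s v <= (indeg s v).+1 /\ indeg s v <= (outdeg s v).+1.
Proof.
have [n le_n] := ubnP (size l); elim: n l le_n => // n IH [|[u v] l] le_n.
  by exists [::].
have [/hasP[e el ve]|/hasPn nv] := boolP (has (fun e => (e.1 == v) || (e.2 == v)) l).
- have /mult_perm lE := perm_to_rem el.
  have [w eE] : exists w, joins e =2 joins (v, w).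
    case: (e) ve => e1 e2 /= /orP[]/eqP ->; first by exists e2.
    by exists e1 => x y; rewrite joins_flip.
  have sz : size (rem e l) = (size l).-1 by rewrite size_rem.
  have lp : 0 < size l by case: (l) el.
  have /IH[s sE sB] : size ((u, w) :: rem e l) < n.
    by rewrite /= sz prednK.
  have : 0 < mult s u w by rewrite sE mult_gt0 inE eqxx.
  rewrite mult_gt0 => /orP[/perm_to_rem|/perm_to_rem]; set s' := rem _ s => ss'.
  + exists ((u, v) :: (v, w) :: s') => x.
      move=> y; have := sE x y.
      by rewrite (mult_perm _ _ ss') !mult_cons lE mult_cons eE; lia.
    have := sB x; rewrite /outdeg /indeg !(permP ss') /=; lia.
  + exists ((w, v) :: (v, u) :: s') => x.
      move=> y; have := sE x y.
      rewrite (mult_perm _ _ ss') !mult_cons lE mult_cons eE.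
      rewrite (joins_flip w u) (joins_flip w v) (joins_flip v u); lia.
    have := sB x; rewrite /outdeg /indeg !(permP ss') /=; lia.
have /IH[s sE sB] : size l < n by move: le_n => /=; lia.
have vs x : ((v, x) \in s) || ((x, v) \in s) = false.
  rewrite -mult_gt0 sE mult_gt0; apply/norP; split; apply/negP => /nv /=;
  by rewrite eqxx ?orbT.
have out0 : outdeg s v = 0.
  apply/eqP; rewrite eqn0Ngt -has_count; apply/hasPn => -[x y] xys /=.
  by apply/eqP => xv; have := vs y; rewrite -xv xys.
have in0 : indeg s v = 0.
  apply/eqP; rewrite eqn0Ngt -has_count; apply/hasPn => -[x y] xys /=.
  by apply/eqP => yv; have := vs x; rewrite -yv xys orbT.
(* No other edge meets [v], so either direction suits [v]; the imbalance at [u] decides. *)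
have [le|gt] := leqP (outdeg s u) (indeg s u).
  exists ((u, v) :: s) => x.
    by move=> y; rewrite mult_cons sE [RHS]mult_cons.
  have := sB x; rewrite /= -!/(outdeg _ _) -!/(indeg _ _).
  move: le out0 in0; case: (eqVneq u x) => [->|_]; case: (eqVneq v x) => [->|_] /=; lia.
exists ((v, u) :: s) => x.
  by move=> y; rewrite mult_cons sE [RHS]mult_cons joins_flip.
have := sB x; rewrite /= -!/(outdeg _ _) -!/(indeg _ _).
move: gt out0 in0; case: (eqVneq u x) => [->|_]; case: (eqVneq v x) => [->|_] /=; lia.
Qed.

End Orientation.

(** * Koenig's edge coloring theorem for bipartite multigraphs *)

Section Koenig.
Variables (E : finType) (X : eqType) (Y : finType) (a : E -> X) (b : E -> Y).
Variable k : nat.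
Local Open Scope set_scope.
Implicit Types (A : {set E}) (c : E -> nat).

(** [E] is the edge set of a bipartite multigraph where [e] joins [a e] to [b e]; restricting to [A]
    permits induction on the number of edges. *)
Definition proper_on A c :=
  [/\ {in A, forall e, c e < k},
      {in A &, forall e f, a e = a f -> c e = c f -> e = f} &
      {in A &, forall e f, b e = b f -> c e = c f -> e = f}].

(** At most [k - 1] edges of [A] share the end [g e0], so they miss a color. Here [g] stands for [a]
    or [b]. *)
Lemma free_color (T : eqType) (g : E -> T) A c (e0 : E) : e0 \notin A ->
  #|[set e in e0 |: A | g e == g e0]| <= k ->
  exists2 i, i < k & {in A, forall e, g e = g e0 -> c e != i}.
Proof.
move=> e0A le.
have /allPn[i] : ~~ all (mem [seq c e | e in [set e in A | g e == g e0]]) (iota 0 k).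
  apply/negP => /allP sub.
  have := uniq_leq_size (iota_uniq 0 k) sub; rewrite size_iota size_map -cardE.
  have := le; rewrite (_ : [set e in e0 |: A | g e == g e0] =
    e0 |: [set e in A | g e == g e0]); last first.
    by apply/setP => e; rewrite !inE; case: eqVneq => // ->; rewrite eqxx.
  by rewrite cardsU1 !inE (negbTE e0A) /=; lia.
rewrite mem_iota => ik nI; exists i => // e eA ge; apply: contra nI => /eqP <-.
by apply: image_f; rewrite inE eA ge eqxx.
Qed.

(** Color all edges but [e0], take [i] free at [a e0] and [j] free at [b e0], exchange [i] and [j]
    along the alternating path from [b e0], then give [i] to [e0]. *)
Lemma koenig_edge_coloring A :
  (forall x, #|[set e in A | a e == x]| <= k) ->
  (forall y, #|[set e in A | b e == y]| <= k) ->
  exists c, proper_on A c.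
Proof.
have [n le_n] := ubnP #|A|; elim: n A le_n => // n IH A le_n ka kb.
have [->|[e0 e0A]] := set_0Vmem A.
  by exists (fun=> 0); split => e; rewrite inE.
pose B := A :\ e0.
have e0B : e0 \notin B by rewrite !inE eqxx.
have AE : A = e0 |: B by rewrite setD1K.
have [c [cl ca cb]] : exists c, proper_on B c.
  apply: IH => [|x|y]; first by have := cardsD1 e0 A; rewrite e0A -/B; lia.
    by apply: leq_trans (ka x); apply/subset_leq_card/subsetP => e;
       rewrite !inE => /andP[/andP[_ ->]].
  by apply: leq_trans (kb y); apply/subset_leq_card/subsetP => e;
     rewrite !inE => /andP[/andP[_ ->]].
have [i ik iE] : exists2 i, i < k & {in B, forall e, a e = a e0 -> c e != i}.
  by apply: free_color => //; rewrite -AE.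
have [j jk jE] : exists2 j, j < k & {in B, forall e, b e = b e0 -> c e != j}.
  by apply: free_color => //; rewrite -AE.
(* [S] is the part in [Y] of the alternating path that leaves [b e0] by an edge
   of color [i]; it cannot meet [a e0], where [i] is missing. *)
pose r y y' := [exists e, exists f,
  [&& e \in B, f \in B, c e == i, c f == j, a e == a f, b e == y & b f == y']].
pose S y := connect r (b e0) y.
(* Both edges are exchanged or neither is. Backwards, a path to [b f] is not empty, as [j] is
   missing at [b e0], and by properness its last step uses [e] and [f]. *)
have SP e f : e \in B -> f \in B -> c e = i -> c f = j -> a e = a f ->
    S (b e) = S (b f).
  move=> eB fB ce cf aef; apply/idP/idP => [Se|].
    apply: connect_trans Se (connect1 _); apply/existsP; exists e.
    by apply/existsP; exists f; rewrite eB fB ce cf aef !eqxx.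
  case/connectP => p; case/lastP: p => [_ /= bf|p y].
    by have := jE f fB bf; rewrite cf eqxx.
  rewrite rcons_path last_rcons => /andP[pP /existsP[e' /existsP[f']]].
  case/and5P => e'B f'B /eqP ce' /eqP cf' /and3P[/eqP aef' /eqP be' /eqP bf'] yE.
  have ff' : f' = f by apply: cb => //; rewrite ?bf' ?cf'.
  have ee' : e' = e by apply: ca => //; rewrite ?aef' ?ff' ?ce'.
  by apply/connectP; exists p; rewrite // -ee' be'.
pose sw n := if n == i then j else if n == j then i else n.
have swK : involutive sw.
  move=> x; rewrite /sw; case: (eqVneq x i) => [->|xi].
    by rewrite eqxx; case: eqVneq.
  by case: (eqVneq x j) => [->|xj]; rewrite ?eqxx // (negbTE xi) (negbTE xj).
have swN x : x != i -> x != j -> sw x = x.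
  by rewrite /sw => /negbTE -> /negbTE ->.
pose c' e := if S (b e) then sw (c e) else c e.
have S0 : S (b e0) by apply: connect0.
have c'b e : e \in B -> b e = b e0 -> c' e != i.
  move=> eB be; rewrite /c' be S0; apply: contra (jE e eB be) => /eqP swi.
  by rewrite -[c e]swK swi /sw eqxx.
(* An edge at [a e0] turned from [j] to [i] would be entered by the path through an edge of color
   [i] at [a e0], where [i] is missing. *)
have c'a e : e \in B -> a e = a e0 -> c' e != i.
  move=> eB ae; rewrite /c'; case: ifP => Se; last exact: iE.
  apply/eqP => swi; have ce : c e = j by rewrite -[c e]swK swi /sw eqxx.
  case/connectP: Se => p; case/lastP: p => [_ /= bf|p y].
    by have := jE e eB bf; rewrite ce eqxx.
  rewrite rcons_path last_rcons => /andP[pP /existsP[e' /existsP[f']]].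
  case/and5P => e'B f'B /eqP ce' /eqP cf' /and3P[/eqP aef' /eqP be' /eqP bf'] yE.
  have ff' : f' = e by apply: cb => //; rewrite ?bf' ?cf'.
  by have := iE e' e'B; rewrite aef' ff' ce' eqxx => /(_ ae).
exists (fun e => if e == e0 then i else c' e); split.
- move=> e; rewrite AE in_setU1; case: (eqVneq e e0) => //= _ eB.
  rewrite /c'; case: ifP => _; last exact: cl.
  by rewrite /sw; case: ifP => // _; case: ifP => // _; apply: cl.
- have c'P e f : e \in B -> f \in B -> a e = a f -> c' e = c' f -> e = f.
    move=> eB fB aef; rewrite /c'.
    (* With only one of two adjacent edges exchanged, [SP] excludes a conflict in [i] or [j]; other
       colors do not change. *)
    have h e1 f1 : e1 \in B -> f1 \in B -> a e1 = a f1 -> S (b e1) -> ~~ S (b f1) ->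
        sw (c e1) = c f1 -> e1 = f1.
      move=> e1B f1B ae1 Se Sf; case: (eqVneq (c e1) i) => [ci|ci].
        rewrite /sw ci eqxx => cj.
        by move: Sf; rewrite -(SP e1 f1) ?Se.
      case: (eqVneq (c e1) j) => [cj|cj]; last by rewrite swN // => /ca ->.
      rewrite /sw cj; case: eqVneq => [ij|_ fi]; first by rewrite -ij cj ij eqxx in ci.
      by move: fi Sf; rewrite eqxx => fi; rewrite (SP f1 e1) ?Se.
    case: (boolP (S (b e))) => Se; case: (boolP (S (b f))) => Sf.
    + by move=> /(inv_inj swK); apply: ca.
    + exact: h.
    + by move=> /esym /h ->.
    + exact: ca.
  move=> e f; rewrite AE !in_setU1.
  case: (eqVneq e e0) => [->|_] /=; case: (eqVneq f e0) => [->|_] //= eB fB.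
  + by move=> aE ic; have := c'a f fB; rewrite -aE -ic eqxx => /(_ erefl).
  + by move=> aE ic; have := c'a e eB aE; rewrite ic eqxx.
  + exact: c'P.
- have c'P e f : e \in B -> f \in B -> b e = b f -> c' e = c' f -> e = f.
    move=> eB fB bef; rewrite /c' bef; case: ifP => _; last exact: cb.
    by move=> /(inv_inj swK); apply: cb.
  move=> e f; rewrite AE !in_setU1.
  case: (eqVneq e e0) => [->|_] /=; case: (eqVneq f e0) => [->|_] //= eB fB.
  + by move=> bE ic; have := c'b f fB; rewrite -bE -ic eqxx => /(_ erefl).
  + by move=> bE ic; have := c'b e eB bE; rewrite ic eqxx.
  + exact: c'P.
Qed.

End Koenig.

(** * Oriented classes with in- and outdegrees at most 1 *)

Section GraphOrientation.
Variables (G : sgraph) (m : nat).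
Local Open Scope set_scope.
Implicit Types u v : G.

Lemma outdeg_sum (s : seq (G * G)) u : outdeg s u = \sum_v count_mem (u, v) s.
Proof.
elim: s => [|[x y] s IH]; first by rewrite big1.
rewrite /outdeg /= in IH *; rewrite IH big_split /=; congr addn.
rewrite (bigD1 y) //= big1 ?addn0 => [|v]; rewrite xpair_eqE; first by rewrite eqxx andbT.
by rewrite eq_sym => /negbTE ->; rewrite andbF.
Qed.

Lemma indeg_sum (s : seq (G * G)) u : indeg s u = \sum_v count_mem (v, u) s.
Proof.
elim: s => [|[x y] s IH]; first by rewrite big1.
rewrite /indeg /= in IH *; rewrite IH big_split /=; congr addn.
rewrite (bigD1 x) //= big1 ?addn0 => [|v]; rewrite xpair_eqE; first by rewrite eqxx.
by rewrite eq_sym => /negbTE ->.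
Qed.

(** In- and outdegree differ by at most 1 and sum to at most [m.*2], so both are at most [m];
    Koenig's theorem then yields the classes [c]. *)
Lemma exists_decomposition : max_degree G <= m.*2 ->
  exists (D : rel G) (c : G -> G -> nat),
  [/\ forall u v, adj u v = D u v || D v u,
      forall u v, D u v -> ~~ D v u,
      forall u v, D u v -> c u v < m,
      forall u v w, D u v -> D u w -> c u v = c u w -> v = w &
      forall u v w, D v u -> D w u -> c v u = c w u -> v = w].
Proof.
move=> degm.
(* Each edge is listed once, directed by increasing rank. *)
pose l := [seq p <- enum {: G * G} | adj p.1 p.2 & enum_rank p.1 < enum_rank p.2].
have ul : uniq l by rewrite filter_uniq // enum_uniq.
have lE u v : mult l u v = adj u v.
  have lm p : (p \in l) = adj p.1 p.2 && (enum_rank p.1 < enum_rank p.2).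
    by rewrite mem_filter mem_enum andbT.
  rewrite /mult !count_uniq_mem // !lm /= [adj v u]adj_sym.
  case: ltngtP => [||/val_inj/enum_rank_inj ->]; rewrite ?andbT ?andbF ?addn0 //.
  by rewrite adj_irrefl.
have [s sE sB] := balanced_orientation l.
have us : uniq s.
  apply: count_mem_uniq => -[u v]; have := sE u v; rewrite lE /mult.
  rewrite -has_pred1 has_count /=.
  by case: (adj u v); lia.
have degE u : outdeg s u + indeg s u = #|neighbors u|.
  rewrite outdeg_sum indeg_sum -big_split /= -sum1_card [RHS]big_mkcond /=.
  apply: eq_bigr => v _; have := sE u v; rewrite lE /mult => ->.
  by rewrite inE; case: adj.
have degle u : #|neighbors u| <= m.*2.
  by apply: leq_trans degm; apply: (leq_bigmax u).
have card_s (P : pred (G * G)) : #|[set e in [set e in s] | P e]| = count P s.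
  rewrite -size_filter -(card_uniqP _) ?filter_uniq //.
  by apply: eq_card => e; rewrite !inE mem_filter andbC.
have [c [cm co ci]] : exists c, @proper_on _ _ _ fst snd m [set e in s] c.
  apply: koenig_edge_coloring => u; rewrite card_s -/(outdeg s u) -/(indeg s u).
    by have := sB u; have := degE u; have := degle u; lia.
  by have := sB u; have := degE u; have := degle u; lia.
exists (fun u v => (u, v) \in s), (fun u v => c (u, v)); split.
- move=> u v; rewrite -mult_gt0 sE lE; by case: adj.
- move=> u v us1; apply/negP => us2; have := sE u v; rewrite lE /mult.
  by rewrite !count_uniq_mem // us1 us2; case: adj.
- by move=> u v uv; apply: cm; rewrite inE.
- by move=> u v w uv uw /co; rewrite !inE => /(_ uv uw erefl) [].
- by move=> u v w uv uw /ci; rewrite !inE => /(_ uv uw erefl) [].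
Qed.

End GraphOrientation.

(** * Incidence colorings as arc colorings, and the lower bound *)

Section Incidences.
Variable G : sgraph.
Local Open Scope set_scope.
Implicit Types (u v : G) (d k : nat).

(* [g u v] is the color of the incidence [(u, uv)], seen as the arc from [u]
   to [v]. *)
Definition arc_coloring d k (g : G -> G -> nat) :=
  [/\ forall u v, adj u v -> 1 <= g u v <= k,
      forall u v w, adj u v -> adj u w -> g u v = g u w -> v = w,
      forall u v, adj u v -> g u v != g v u &
      forall u c, #|[set v | adj u v & g v u == c]| <= d].

Lemma neighbor_neq u v : adj u v -> u != v.
Proof. by apply: contraL => /eqP <-; rewrite adj_irrefl. Qed.

Lemma set2_inj u v w : u != v -> [set u; v] = [set u; w] -> v = w.
Proof.
move=> uv /setP /(_ v); rewrite !inE eqxx orbT eq_sym (negbTE uv).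
by move=> /esym/eqP.
Qed.

Lemma arc_coloring_colorable d k g :
  arc_coloring d k g -> defective_incidence_colorable G d k.
Proof.
move=> [gk go gr gi].
(* The end of [e] other than [u]; the default [u] occurs only if [e] is not an edge at [u]. *)
pose other u (e : {set G}) := odflt u [pick v | e == [set u; v] & adj u v].
have otherE u v : adj u v -> other u [set u; v] = v.
  move=> uv; rewrite /other; case: pickP => [w /andP[/eqP/set2_inj]|/(_ v)].
    by move/(_ (neighbor_neq uv)).
  by rewrite eqxx uv.
have otherE' u v : adj u v -> other v [set u; v] = u.
  by move=> uv; rewrite setUC otherE // adj_sym.
exists (fun i => g i.1 (other i.1 i.2)); split.
  move=> [u e]; rewrite inE => /= /andP[/imsetP[[x y]]]; rewrite inE /= => xy ->.
  rewrite !inE => /orP[]/eqP ->; first by rewrite otherE // gk.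
  by rewrite otherE' // gk // adj_sym.
move=> u; split => [v w|v|c _].
- rewrite !inE /= => uv uw; rewrite !otherE //; apply: contra => /eqP.
  by move=> /go -> //.
- by rewrite !inE /= => uv; rewrite otherE // otherE' // gr.
apply: leq_trans (gi u c).
rewrite -(card_imset _ (can_inj (f := fun v => (v, [set u; v])) (g := fst) _)) //.
apply/subset_leq_card/subsetP => i; rewrite inE => /andP[/imsetP[v]].
rewrite inE => uv -> /= gc; apply/imsetP; exists v => //.
by rewrite inE uv; move: gc; rewrite otherE'.
Qed.

(** The strong incidences of one vertex have distinct colors. *)
Lemma chromatic_ge_max_degree d :
  max_degree G <= defective_incidence_chromatic G d.
Proof.
rewrite /defective_incidence_chromatic; case: ex_minnP => k /asboolP[phi [phik phiP]] _.
apply/bigmax_leqP => u _; have [phio _ _] := phiP u.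
rewrite cardE -(size_map (fun v => phi (u, [set u; v]))) -[leqRHS](size_iota 1).
apply: uniq_leq_size => [|c /mapP[v]].
  rewrite map_inj_in_uniq ?enum_uniq // => v w; rewrite !mem_enum => uv uw eq_phi.
  by apply/eqP/negPn/negP => /(phio _ _ uv uw); rewrite eq_phi eqxx.
rewrite mem_enum inE => uv ->; rewrite mem_iota add1n ltnS; apply: phik.
rewrite inE /= !inE eqxx /= andbT; apply/imsetP; exists (u, v) => //=.
by rewrite inE.
Qed.

(** * Arc colorings for even and odd maximum degree *)

Lemma card_le2 (T : finType) (A : {set T}) (P Q : pred T) :
  {in A, forall x, P x || Q x} ->
  {in A &, forall x y, P x -> P y -> x = y} ->
  {in A &, forall x y, Q x -> Q y -> x = y} -> #|A| <= 2.
Proof.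
move=> APQ AP AQ.
have le1 (R : pred T) : {in A &, forall x y, R x -> R y -> x = y} ->
    #|[set x in A | R x]| <= 1.
  move=> AR; apply/card_le1P => x; rewrite inE => /andP[xA Rx] y.
  rewrite !inE; apply/andP/eqP => [[yA Ry]|->] //; exact: AR.
apply: leq_trans (leq_add (le1 _ AP) (le1 _ AQ)).
apply: leq_trans (leq_card_setU _ _).1.
by apply/subset_leq_card/subsetP => x xA; rewrite !inE xA /= APQ.
Qed.

(** Class [j] gets the color [j + 1] forward and [k + j + 1] backward, so the two ranges are
    disjoint. *)
Lemma arc_coloring_even k : max_degree G = k.*2 -> exists g, arc_coloring 2 k.*2 g.
Proof.
move=> Dk; have [|D [c [DE Dn ck co ci]]] := @exists_decomposition G k; first by rewrite Dk.
exists (fun u v => if D u v then (c u v).+1 else k + (c v u).+1); split.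
- move=> u v; rewrite DE; case: ifP => [uv _|_ /= vu]; last by have := ck _ _ vu; lia.
  by have := ck _ _ uv; lia.
- move=> u v w; rewrite !DE; case: ifP => uv; case: ifP => uw //= vu wu.
  + by case=> /co; apply.
  + by have := ck _ _ uv; lia.
  + by have := ck _ _ uw; lia.
  + by move=> e; apply: (ci u) => //; lia.
- move=> u v; rewrite DE; case: ifP => [uv _|uv /= vu]; last by rewrite vu; have := ck _ _ vu; lia.
  by rewrite (negbTE (Dn _ _ uv)); have := ck _ _ uv; lia.
- move=> u x; apply: (@card_le2 _ _ (fun v => D v u) (fun v => D u v)) => v.
  + by rewrite inE DE orbC => /andP[].
  + move=> w; rewrite !inE => /andP[_ /eqP vx] /andP[_ /eqP wx] vu wu.
    by move: vx wx; rewrite vu wu => <- [/esym /ci]; apply.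
  + move=> w; rewrite !inE => /andP[_ /eqP vx] /andP[_ /eqP wx] uv uw.
    move: vx wx; rewrite (negbTE (Dn _ _ uv)) (negbTE (Dn _ _ uw)) => vx wx.
    by apply: (co u) => //; lia.
Qed.

(* The arcs of [D] of color 0, and those of color 1 that leave a vertex without
   an outgoing arc of color 0, all get the label 1; other arcs of [D] of color
   [j] get the label [j + 1], and reversed arcs of color [j > 0] the label
   [k + 1 + j]. The reverse [uw] of an arc of color 0 gets a label [z u > 1]
   that no other arc leaving [u] has: [u] has at most [2k] other outgoing arcs,
   and they have label 1 if they have label 2. *)
Lemma arc_coloring_odd k : 0 < k -> max_degree G = k.*2.+1 ->
  exists g, arc_coloring 2 k.*2.+1 g.
Proof.
move=> k0 Dk; have [|D [c [DE Dn ck co ci]]] := @exists_decomposition G k.+1.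
  by rewrite Dk; lia.
pose first u v := (c u v == 0) || (c u v == 1) && ~~ [exists w, D u w && (c u w == 0)].
pose fw u v := if first u v then 1 else (c u v).+1.
pose g0 u v := if D u v then fw u v else k.+1 + c v u.
pose special u v := D v u && (c v u == 0).
(* Label 1 goes to class 1 at [u] only when no arc of class 0 leaves [u]. *)
have fw_inj u v w : D u v -> D u w -> fw u v = fw u w -> v = w.
  move=> uv uw; have cvw := co _ _ _ uv uw; rewrite /fw /first.
  have [/existsP[x /andP[ux /eqP x0]]|/existsPn no] := boolP [exists w, D u w && (c u w == 0)].
    by rewrite /= !andbF !orbF; do 2 case: eqP; move=> *; apply: cvw; lia.
  have := no v; have := no w; rewrite uv uw /= => w0 v0.
  rewrite (negbTE w0) (negbTE v0) !andbT /=.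
  by do 2 case: eqP; move=> *; apply: cvw; lia.
have fwle u v : D u v -> 1 <= fw u v <= k.+1.
  by move=> /ck; rewrite /fw; case: ifP => //; lia.
have fw1 u v : D u v -> fw u v = 1 -> (c u v == 0) || (c u v == 1).
  move=> uv; rewrite /fw /first; do 2 case: eqP => //=; lia.
have fwN1 u v : D u v -> fw u v != 1 -> fw u v = (c u v).+1.
  by rewrite /fw; case: ifP.
(* The premise sits under the quantifier on [z] so that [choice] gives a function on all
   vertices. *)
have zP u : exists z, (exists w, special u w) ->
    1 < z <= k.*2.+1 /\ forall v, adj u v -> ~~ special u v -> g0 u v != z.
  have [/existsP[w sw]|/existsPn no] := boolP [exists w, special u w]; last first.
    by exists 0 => -[w]; rewrite (negbTE (no w)).
  pose U := [seq g0 u v | v in [set v in neighbors u | ~~ special u v]].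
  have UP v : adj u v -> ~~ special u v -> g0 u v \in U.
    by move=> uv sv; apply: image_f; rewrite !inE uv.
  have szU : size U <= k.*2.
    rewrite size_map -cardE -ltnS -Dk.
    apply: leq_trans (leq_bigmax u); apply: proper_card; apply/properP; split.
      by apply/subsetP => v; rewrite inE => /andP[].
    by exists w; rewrite !inE ?sw ?andbF // DE; case/andP: sw => ->; rewrite orbT.
  have /allPn[z zr zU] : ~~ all (mem U) (iota 2 k.*2).
    apply/negP => /allP sub.
    (* Reverse arcs that are not special have labels at least [k + 2 > 2], so label 2 comes from an
       arc of class 1 denied label 1 by an arc of class 0. Then [U] would hold all [k.*2.+1]
       labels. *)
    have U1 : 1 \in U.
      have /sub/imageP[v] : 2 \in iota 2 k.*2 by rewrite mem_iota; lia.
      rewrite !inE => /andP[uv sv]; rewrite /g0.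
      have [Duv|Duv] := boolP (D u v); last first.
        move: uv sv; rewrite /special DE (negbTE Duv) /= => -> /=.
        by have := k0; case: (c v u) => //; lia.
      rewrite /fw; case: ifP => // nf [c1].
      move: nf; rewrite /first -c1 /= => /negbFE /existsP[x /andP[ux cx]].
      have gx : g0 u x = 1 by rewrite /g0 ux /fw /first cx.
      rewrite -gx; apply: UP; first by rewrite DE ux.
      by rewrite /special (negbTE (Dn _ _ ux)).
    have : size (iota 1 k.*2.+1) <= size U; last by rewrite size_iota; lia.
    apply: uniq_leq_size (iota_uniq _ _) _ => x; rewrite mem_iota => xr.
    by have [->//|x1] := eqVneq x 1; apply: sub; rewrite mem_iota; lia.
  exists z => _; split; first by move: zr; rewrite mem_iota; lia.
  by move=> v uv sv; apply: contra zU => /eqP <-; apply: UP.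
have [z zE] := choice zP.
pose g u v := if special u v then z u else g0 u v.
have spD u v : D u v -> special u v = false.
  by move=> /Dn/negbTE; rewrite /special => ->.
have zr u v : special u v -> 1 < z u <= k.*2.+1.
  by move=> sv; case: (zE u) => //; exists v.
have gfw u v : D u v -> g u v = fw u v by move=> uv; rewrite /g /g0 (spD _ _ uv) uv.
have gbw u v : D v u -> c v u != 0 -> g u v = k.+1 + c v u.
  by move=> vu /negbTE cvu; rewrite /g /g0 /special cvu andbF (negbTE (Dn _ _ vu)).
have gsp u v : special u v -> g u v = z u by rewrite /g => ->.
have bwP u v : D v u -> special u v \/ c v u != 0.
  by rewrite /special => ->; case: eqP; [left|right].
exists g; split.
- move=> u v; rewrite DE => /orP[uv|vu].
    by rewrite gfw //; have := fwle _ _ uv; lia.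
  have [sv|cv] := bwP _ _ vu; first by rewrite gsp //; have := zr _ _ sv; lia.
  by rewrite gbw //; have := ck _ _ vu; lia.
- move=> u v w auv auw; rewrite /g.
  case: (boolP (special u v)) => sv; case: (boolP (special u w)) => sw.
  + move=> _; case/andP: sv sw => vu /eqP v0 /andP[wu /eqP w0].
    by apply: (ci u); rewrite ?v0.
  + by case: (zE u) => [|_ /(_ w auw sw)]; [exists v | move=> /eqP h /esym].
  + by case: (zE u) => [|_ /(_ v auv sv)]; [exists w | move=> /eqP h].
  + rewrite /g0; case: ifP => uv; case: ifP => uw.
    * exact: fw_inj.
    * move: auw sw; rewrite /special DE uw /= => wu; rewrite wu /=.
      by have := fwle _ _ uv; lia.
    * move: auv sv; rewrite /special DE uv /= => vu; rewrite vu /=.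
      by have := fwle _ _ uw; lia.
    * move: auv auw; rewrite !DE uv uw /= => vu wu e.
      by apply: (ci u) => //; lia.
- have half u v : D u v -> g u v != g v u.
    move=> uv; rewrite gfw //; have [sv|cv] := bwP _ _ uv.
      rewrite gsp // /fw /first; case/andP: (sv) => _ ->.
      by have := zr _ _ sv => /=; lia.
    rewrite gbw //; have := fwle _ _ uv; lia.
  move=> u v; rewrite DE => /orP[|] /half //; by rewrite eq_sym.
(* Label 1 enters [u] only by arcs of [D] in class 0 or 1, at most one of each. *)
- move=> u x; have [->|x1] := eqVneq x 1.
    have in1 v : v \in [set v | adj u v & g v u == 1] ->
        D v u /\ (c v u == 0) || (c v u == 1).
      rewrite inE DE => /andP[/orP[uv|vu] /eqP gv]; last first.
        by split=> //; apply: fw1; rewrite -?gfw.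
      have [sv|cv] := bwP _ _ uv; last by move: gv; rewrite gbw //; lia.
      by have := zr _ _ sv; rewrite -(gsp _ _ sv) gv.
    apply: (@card_le2 _ _ (fun v => c v u == 0) (fun v => c v u == 1)) => v.
    + by case/in1.
    + by move=> w /in1[vu _] /in1[wu _] /eqP v0 /eqP w0; apply: (ci u); rewrite ?v0.
    + by move=> w /in1[vu _] /in1[wu _] /eqP v0 /eqP w0; apply: (ci u); rewrite ?v0.
  have inN v : D v u -> g v u = x -> x = (c v u).+1.
    by move=> vu gx; rewrite -gx gfw // fwN1 // -gfw // gx.
  have outN v : D u v -> c u v != 0 -> g v u = x -> x = k.+1 + c u v.
    by move=> uv cv <-; rewrite gbw.
  (* For [x != 1], forward labels are at most [k + 1] and ordinary reverse labels exceed it, so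
     these two kinds give one arc together; the only special reverse arc into [u] may add a
     second. *)
  apply: (@card_le2 _ _ (fun v => D v u || D u v && (c u v != 0))
                        (fun v => D u v && (c u v == 0))) => v.
  + by rewrite inE DE => /andP[/orP[] -> _]; case: (_ == _); rewrite ?orbT.
  + move=> w; rewrite !inE => /andP[_ /eqP vx] /andP[_ /eqP wx].
    move=> /orP[vu|/andP[uv cv]] /orP[wu|/andP[uw cw]].
    * by have := inN _ vu vx; rewrite (inN _ wu wx) => -[/esym /ci]; apply.
    * by have := inN _ vu vx; have := outN _ uw cw wx; have := ck _ _ vu; lia.
    * by have := inN _ wu wx; have := outN _ uv cv vx; have := ck _ _ wu; lia.
    * have := outN _ uv cv vx; have := outN _ uw cw wx => h1 h2.
      by apply: (co u) => //; lia.
  + move=> w _ _ /andP[uv /eqP v0] /andP[uw /eqP w0].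
    by apply: (co u); rewrite ?v0.
Qed.

End Incidences.

Theorem theorem8 (R : realType) (G : sgraph) (hG : outerplanar R G)
    (hDelta : 2 <= max_degree G) (d : nat) (hd : 2 <= d) :
  defective_incidence_chromatic G d = max_degree G.
Proof.
apply/eqP; rewrite eqn_leq chromatic_ge_max_degree andbT.
have [g [gk go gr gi]] : exists g, arc_coloring (G := G) 2 (max_degree G) g.
  have := odd_double_half (max_degree G); case: odd; rewrite ?add0n ?add1n => DE.
    (* An odd maximum degree is at least 3 here, whence [0 < k]. *)
    by rewrite -DE; apply: arc_coloring_odd; lia.
  by rewrite -DE; apply: arc_coloring_even.
have gd : arc_coloring d (max_degree G) g.
  by split=> // u c; apply: leq_trans (gi u c) hd.
rewrite /defective_incidence_chromatic; case: ex_minnP => k _; apply.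
exact/asboolP/arc_coloring_colorable/gd.
Qed.
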